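(* Let $R$ be a ring with identity and an anti-involution $x\mapsto\bar x$. There exists a well-defined homomorphism $$\vartheta=\vartheta_R\colon HQ_1(R)\to\mathrm{coker}(\mu_{R/2R})=\frac{HQ_1(R/2R)}{\mathrm{Span}\{[x\otimes x,0]\mid x\in R\}}$$ defined by $$\Bigl[\sum_{i=1}^n\alpha_i\otimes\beta_i,\,c\Bigr]\mapsto\Bigl[\sum_{i=1}^n\alpha_i\beta_i\alpha_i\otimes\beta_i+\sum_{i=1}^n\alpha_i\beta_i\otimes\beta_i\alpha_i+\sum_{i<j}(\alpha_i\beta_i+\beta_i\alpha_i)\otimes(\alpha_j\beta_j+\beta_j\alpha_j)+c\otimes\bar c,\;c^2\Bigr].$$
   Context: $\otimes=\otimes_{\mathbb Z}$, $b(r\otimes s)=rs-sr$. The first quaternionic homology group $HQ_1(R)$ is (canonically isomorphic to, and here identified with) the quotient of $\{(\xi,c)\in(R\otimes R)\oplus R\mid b(\xi)+c-\bar c=0\}$ by the subgroup generated by all elements $(r\otimes s+s\otimes r,\,-rs-\overline{rs})$, $(u\otimes v+\bar u\otimes\bar v,\,vu-uv)$, $(0,\,2(w+\bar w))$, $(xy\otimes z-x\otimes yz+zx\otimes y,\,0)$, with $r,s,u,v,w,x,y,z\in R$. The class of $(\xi,c)$ is written $[\xi,c]$. The homomorphism $\nu_R\colon R\to HQ_1(R)$ is $x\mapsto[1\otimes x,0]$, and $\mu_R\colon R\to\mathrm{coker}(\nu_R)$ is the homomorphism $x\mapsto[x\otimes x,0]$. In the target, $\mu_{R/2R}$ is this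 map for the ring $R/2R$ with the induced anti-involution. *)

(* Defs.v *)
From HB Require Import structures.
From mathcomp Require Import all_boot all_algebra.
From mathcomp Require Import boolp.
From mathcomp Require Import freeg.

Set Implicit Arguments.
Unset Strict Implicit.
Unset Printing Implicit Defensive.

Import GRing.Theory.
Local Open Scope ring_scope.
Local Open Scope quotient_scope.

Section SubgroupQuotient.
Variables (V : zmodType) (S : V -> Prop).

(* The subgroup of V generated by S. *)
Inductive span : V -> Prop :=
| span_in x : S x -> span x
| span_0 : span 0
| span_B x y : span x -> span y -> span (x - y).

Definition spanb : {pred V} := fun x => `[< span x >].

Lemma spanP x : reflect (span x) (x \in spanb).
Proof. exact: asboolP. Qed.

Fact spanb_zmod_closed : zmod_closed spanb.
Proof.
split; first by apply/spanP; exact: span_0.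
by move=> x y /spanP xS /spanP yS; apply/spanP; exact: span_B.
Qed.

HB.instance Definition _ := GRing.isZmodClosed.Build V spanb spanb_zmod_closed.

(* The quotient of V by the subgroup generated by S. *)
Definition gquot : Type := {ideal_quot spanb}.

HB.instance Definition _ := GRing.Zmodule.on gquot.

Definition qproj (x : V) : gquot := \pi_{ideal_quot spanb} x.

Fact qproj_is_zmod_morphism : zmod_morphism qproj.
Proof. by move=> x y; rewrite /qproj raddfB. Qed.

HB.instance Definition _ :=
  GRing.isZmodMorphism.Build V gquot qproj qproj_is_zmod_morphism.

Definition qrepr (q : gquot) : V := repr (q : {ideal_quot spanb}).

Lemma qreprK q : qproj (qrepr q) = q.
Proof. exact: reprK. Qed.

Lemma qproj_eq x y : qproj x = qproj y <-> span (x - y).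
Proof.
split=> [/eqP|] xy; first by apply/spanP; rewrite Quotient.idealrBE.
by apply/eqP; rewrite -[_ == _]Quotient.idealrBE; apply/spanP.
Qed.

Lemma qproj_eq0 x : qproj x = 0 <-> span x.
Proof. by rewrite -(raddf0 qproj) qproj_eq subr0. Qed.

Lemma span_ker (W : zmodType) (f : {additive V -> W}) :
  (forall x, S x -> f x = 0) -> forall x, span x -> f x = 0.
Proof.
move=> fS x; elim=> {x} [x /fS //||x y _ fx _ fy]; first exact: raddf0.
by rewrite raddfB fx fy subrr.
Qed.

End SubgroupQuotient.

Definition coker (A B : zmodType) (f : {additive A -> B}) : Type :=
  gquot (fun y => exists x, y = f x).

HB.instance Definition _ (A B : zmodType) (f : {additive A -> B}) :=
  GRing.Zmodule.on (coker f).

Definition cokproj (A B : zmodType) (f : {additive A -> B}) : B -> coker f :=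
  @qproj B _.

HB.instance Definition _ (A B : zmodType) (f : {additive A -> B}) :=
  GRing.Additive.on (@cokproj A B f).

Section Tensor.
Variables V W : zmodType.

(* V ⊗ W over the integers: the free abelian group on V * W modulo
   biadditivity. *)
Inductive bilin_rel : {freeg (V * W)} -> Prop :=
| bilin_relDl v v' w :
    bilin_rel (<< (v + v', w) >> - << (v, w) >> - << (v', w) >>)
| bilin_relDr v w w' :
    bilin_rel (<< (v, w + w') >> - << (v, w) >> - << (v, w') >>).

Definition tensor : Type := gquot bilin_rel.

HB.instance Definition _ := GRing.Zmodule.on tensor.

Definition tens (v : V) (w : W) : tensor := qproj bilin_rel << (v, w) >>.

Lemma tensDl v v' w : tens (v + v') w = tens v w + tens v' w.
Proof.
apply/eqP; rewrite -subr_eq0 opprD addrA; apply/eqP.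
by rewrite /tens -!raddfB; apply/qproj_eq0/span_in; exact: bilin_relDl.
Qed.

Lemma tensDr v w w' : tens v (w + w') = tens v w + tens v w'.
Proof.
apply/eqP; rewrite -subr_eq0 opprD addrA; apply/eqP.
by rewrite /tens -!raddfB; apply/qproj_eq0/span_in; exact: bilin_relDr.
Qed.

Lemma tensor_sumE (t : tensor) :
  exists n (v : 'I_n -> V) (w : 'I_n -> W), t = \sum_(i < n) tens (v i) (w i).
Proof.
suff [s ->] : exists s : seq (V * W), t = \sum_(p <- s) tens p.1 p.2.
  exists (size s), (fun i => (tnth (in_tuple s) i).1).
  by exists (fun i => (tnth (in_tuple s) i).2); rewrite big_tnth.
pose P u := exists s : seq (V * W), u = \sum_(p <- s) tens p.1 p.2.
have P0 : P 0 by exists [::]; rewrite big_nil.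
have PD u u' : P u -> P u' -> P (u + u').
  by move=> [s ->] [s' ->]; exists (s ++ s'); rewrite big_cat.
have tensNl v w : tens (- v) w = - tens v w.
  apply: (addrI (tens v w)); rewrite -tensDl !subrr.
  by apply: (addrI (tens 0 w)); rewrite -tensDl !addr0.
have PN u : P u -> P (- u).
  move=> [s ->]; exists [seq (- p.1, p.2) | p <- s].
  by rewrite big_map -sumrN; apply: eq_bigr => p _; rewrite tensNl.
have PMz u (k : int) : P u -> P (u *~ k).
  move=> Pu; have PMn n : P (u *+ n).
    by elim: n => [|n IHn]; rewrite ?mulr0n // mulrS; apply: PD.
  by case: k => n; rewrite ?NegzE ?mulrNz; [exact: PMn|exact/PN/PMn].
rewrite -[t]qreprK -[qrepr t]freeg_sumE raddf_sum /=.
elim/big_rec: _ => [//|[v w] u _ Pu]; apply: PD => //.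
have -> k : << k *g (v, w) >> = << (v, w) >> *~ k :> {freeg (V * W)}.
  by rewrite freegU_mulz intz.
by rewrite raddfMz; apply: PMz; exists [:: (v, w)]; rewrite big_seq1.
Qed.

Section Lift.
Variables (U : zmodType) (f : V -> W -> U).

Definition free_lift : {freeg (V * W)} -> zmodule U :=
  fglift (fun p : V * W => f p.1 p.2 : zmodule U).

HB.instance Definition _ := GRing.isZmodMorphism.Build
  {freeg (V * W)} (zmodule U) free_lift (@lift_is_additive _ _ _ _).

Lemma free_liftU p : free_lift << p >> = f p.1 p.2.
Proof. by rewrite /free_lift liftU scale1r. Qed.

Definition tlift (t : tensor) : U := free_lift (qrepr t).

Hypothesis fDl : forall v v' w, f (v + v') w = f v w + f v' w.
Hypothesis fDr : forall v w w', f v (w + w') = f v w + f v w'.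

Lemma tlift_proj D : tlift (qproj bilin_rel D) = free_lift D.
Proof.
apply/eqP; rewrite -subr_eq0 /tlift -raddfB; apply/eqP.
apply: (@span_ker _ bilin_rel); last by apply/qproj_eq; rewrite qreprK.
move=> _ [v v' w|v w w']; rewrite !raddfB /= !free_liftU /= ?fDl ?fDr.
  by rewrite addrAC addrK subrr.
by rewrite addrAC addrK subrr.
Qed.

Lemma tliftE v w : tlift (tens v w) = f v w.
Proof. by rewrite tlift_proj free_liftU. Qed.

Lemma tlift_is_zmod_morphism : zmod_morphism tlift.
Proof.
move=> s t; rewrite -[s]qreprK -[t]qreprK -raddfB !tlift_proj.
exact: raddfB.
Qed.

End Lift.
End Tensor.

Notation "v ⊗ w" := (tens v w) (at level 39, left associativity).

(* The ring may be trivial: R/2R is the zero ring when 2 is invertible. *)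
HB.mixin Record hasAntiInvolution R of GRing.PzRing R := {
  bar : R -> R;
  barD : forall x y, bar (x + y) = bar x + bar y;
  barM : forall x y, bar (x * y) = bar y * bar x;
  barK : involutive bar
}.

#[short(type="antiInvRingType")]
HB.structure Definition AntiInvRing :=
  {R of GRing.PzRing R & hasAntiInvolution R}.

Section BarTheory.
Variable R : antiInvRingType.

Lemma bar1 : bar (1 : R) = 1.
Proof. by rewrite -[LHS]mulr1 -{2}[1]barK -barM mulr1 barK. Qed.

Fact bar_is_zmod_morphism : zmod_morphism (@bar R).
Proof.
have bar0 : bar (0 : R) = 0 by apply: (addrI (bar 0)); rewrite -barD !addr0.
move=> x y; rewrite barD; congr (_ + _).
by apply: (addrI (bar y)); rewrite -barD !subrr.
Qed.

HB.instance Definition _ :=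
  GRing.isZmodMorphism.Build R R (@bar R) bar_is_zmod_morphism.

End BarTheory.

Section Mod2.
Variable R : antiInvRingType.

Definition even (x : R) : Prop := exists y, x = y *+ 2.

Definition mod2 : Type := gquot even.

HB.instance Definition _ := GRing.Zmodule.on mod2.

Definition to_mod2 : R -> mod2 := @qproj R even.

HB.instance Definition _ := GRing.Additive.on to_mod2.

Definition mod2_one : mod2 := to_mod2 1.
Definition mod2_mul (p q : mod2) : mod2 := to_mod2 (qrepr p * qrepr q).
Definition mod2_bar (p : mod2) : mod2 := to_mod2 (bar (qrepr p)).

Lemma to_mod2K p : to_mod2 (qrepr p) = p.
Proof. exact: qreprK. Qed.

Lemma to_mod2P x y : to_mod2 x = to_mod2 y <-> exists z, x = y + z *+ 2.
Proof.
split=> [/qproj_eq|[z ->]]; last first.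
  by apply/qproj_eq/span_in; exists z; rewrite addrC addKr.
move: (x - y) (subrKC y x) => t <- {x}.
elim=> {t} [_ [z ->]||_ _ _ [z /addrI ->] _ [w /addrI ->]]; first by exists z.
  by exists 0; rewrite mul0rn.
by exists (z - w); rewrite mulrnBl.
Qed.

Lemma to_mod2M x y : to_mod2 (x * y) = mod2_mul (to_mod2 x) (to_mod2 y).
Proof.
rewrite /mod2_mul; have /to_mod2P[u ->] := to_mod2K (to_mod2 x).
have /to_mod2P[v ->] := to_mod2K (to_mod2 y).
apply/esym/to_mod2P; exists (x * v + u * (y + v *+ 2)).
by rewrite mulrDl mulrnAl [x * _]mulrDr mulrnAr mulrnDl -!addrA.
Qed.

Lemma to_mod2_bar x : to_mod2 (bar x) = mod2_bar (to_mod2 x).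
Proof.
rewrite /mod2_bar; have /to_mod2P[u ->] := to_mod2K (to_mod2 x).
by apply/esym/to_mod2P; exists (bar u); rewrite raddfD raddfMn.
Qed.

Fact mod2_mulA : associative mod2_mul.
Proof.
move=> p q r; rewrite -[p]to_mod2K -[q]to_mod2K -[r]to_mod2K.
by rewrite -!to_mod2M mulrA.
Qed.

Fact mod2_mul1l : left_id mod2_one mod2_mul.
Proof. by move=> p; rewrite -[p]to_mod2K -to_mod2M mul1r. Qed.

Fact mod2_mul1r : right_id mod2_one mod2_mul.
Proof. by move=> p; rewrite -[p]to_mod2K -to_mod2M mulr1. Qed.

Fact mod2_mulDl : left_distributive mod2_mul +%R.
Proof.
move=> p q r; rewrite -[p]to_mod2K -[q]to_mod2K -[r]to_mod2K.
by rewrite -raddfD -!to_mod2M mulrDl raddfD.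
Qed.

Fact mod2_mulDr : right_distributive mod2_mul +%R.
Proof.
move=> p q r; rewrite -[p]to_mod2K -[q]to_mod2K -[r]to_mod2K.
by rewrite -raddfD -!to_mod2M mulrDr raddfD.
Qed.

HB.instance Definition _ := GRing.Zmodule_isPzRing.Build mod2
  mod2_mulA mod2_mul1l mod2_mul1r mod2_mulDl mod2_mulDr.

Fact to_mod2_is_monoid_morphism : monoid_morphism to_mod2.
Proof. by split=> // x y; rewrite to_mod2M. Qed.

HB.instance Definition _ :=
  GRing.isMonoidMorphism.Build R mod2 to_mod2 to_mod2_is_monoid_morphism.

Fact mod2_barD p q : mod2_bar (p + q) = mod2_bar p + mod2_bar q.
Proof.
rewrite -[p]to_mod2K -[q]to_mod2K.
by rewrite -raddfD -!to_mod2_bar raddfD raddfD.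
Qed.

Fact mod2_barM p q : mod2_bar (p * q) = mod2_bar q * mod2_bar p.
Proof.
rewrite -[p]to_mod2K -[q]to_mod2K.
by rewrite -rmorphM -!to_mod2_bar barM rmorphM.
Qed.

Fact mod2_barK : involutive mod2_bar.
Proof. by move=> p; rewrite -[p]to_mod2K -!to_mod2_bar barK. Qed.

HB.instance Definition _ :=
  hasAntiInvolution.Build mod2 mod2_barD mod2_barM mod2_barK.

Lemma bar_to_mod2 x : bar (to_mod2 x) = to_mod2 (bar x).
Proof. by rewrite to_mod2_bar. Qed.

End Mod2.

Section HQ1.
Variable R : antiInvRingType.
Implicit Types (r s u v w x y z c : R) (xi : tensor R R).

Definition hoch_b : tensor R R -> R := tlift (fun r s => r * s - s * r).

Fact commDl r r' s :
  (r + r') * s - s * (r + r') = r * s - s * r + (r' * s - s * r') :> R.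
Proof. by rewrite mulrDl mulrDr opprD addrACA. Qed.

Fact commDr r s s' :
  r * (s + s') - (s + s') * r = r * s - s * r + (r * s' - s' * r) :> R.
Proof. by rewrite mulrDl mulrDr opprD addrACA. Qed.

HB.instance Definition _ := GRing.isZmodMorphism.Build (tensor R R) R hoch_b
  (tlift_is_zmod_morphism commDl commDr).

Lemma hoch_bE r s : hoch_b (r ⊗ s) = r * s - s * r.
Proof. exact: (tliftE commDl commDr). Qed.

Definition is_cycle : {pred tensor R R * R} :=
  fun p => hoch_b p.1 + p.2 - bar p.2 == 0.

Lemma is_cycleP xi c :
  reflect (hoch_b xi + c - bar c = 0) ((xi, c) \in is_cycle).
Proof. exact: eqP. Qed.

Fact is_cycle_zmod_closed : zmod_closed is_cycle.
Proof.
split; first by apply/is_cycleP; rewrite !raddf0 !addr0.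
case=> [xi c] [xi' c'] /is_cycleP h /is_cycleP h'; apply/is_cycleP => /=.
rewrite !raddfB /= -[RHS](subrr 0) -{1}h -{1}h'.
rewrite (addrACA (hoch_b xi)) -opprD.
by rewrite opprK addrACA [- (_ - bar c')]opprB [bar c' - _]addrC.
Qed.

HB.instance Definition _ :=
  GRing.isZmodClosed.Build (tensor R R * R)%type is_cycle is_cycle_zmod_closed.

Record cycles := Cycle {
  cycle_val :> tensor R R * R;
  cycle_valP : cycle_val \in is_cycle
}.

HB.instance Definition _ := [isSub for cycle_val].
HB.instance Definition _ := [Choice of cycles by <:].
HB.instance Definition _ := [SubChoice_isSubZmodule of cycles by <:].

(* Every such relator is a cycle (hq_rel_cycle), so restricting the relation
   to cycles in HQ1 discards nothing. *)
Inductive hq_rel : tensor R R * R -> Prop :=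
| hq_rel_sym r s : hq_rel (r ⊗ s + s ⊗ r, - (r * s) - bar (r * s))
| hq_rel_bar u v : hq_rel (u ⊗ v + bar u ⊗ bar v, v * u - u * v)
| hq_rel_two w : hq_rel (0, (w + bar w) *+ 2)
| hq_rel_hoch x y z :
    hq_rel ((x * y) ⊗ z - x ⊗ (y * z) + (z * x) ⊗ y, 0).

Let subrA (V : zmodType) (a b : V) : a - b + (b - a) = 0.
Proof. by rewrite addrA subrK subrr. Qed.

Let subrA3 (V : zmodType) (a b c : V) : a - b + (c - a) + (b - c) = 0.
Proof. by rewrite [a - b + _]addrC (addrA (c - a)) subrK subrA. Qed.

Lemma hq_rel_cycle p : hq_rel p -> p \in is_cycle.
Proof.
case=> {p} [r s|u v|w|x y z]; apply/is_cycleP.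
- rewrite raddfD /= !hoch_bE subrA add0r.
  by rewrite [bar (_ - _)]raddfB /= [bar (- _)]raddfN /= barK opprB opprK
    -opprD addNr.
- rewrite raddfD /= !hoch_bE [bar (_ - _)]raddfB /= !barM addrAC addrK.
  exact: subrA.
- by rewrite raddf0 add0r [bar (_ *+ _)]raddfMn /= barD barK [bar w + w]addrC subrr.
- rewrite raddfD raddfB /= !hoch_bE [bar 0]raddf0 subr0 addr0 !mulrA opprB.
  exact: subrA3.
Qed.

Definition HQ1 : Type := gquot (fun p : cycles => hq_rel p).

HB.instance Definition _ := GRing.Zmodule.on HQ1.

Definition hq_proj : cycles -> HQ1 := @qproj cycles _.

HB.instance Definition _ := GRing.Additive.on hq_proj.

(* The class [xi, c]; it is defined only for pairs satisfying the cycle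
   condition, so the proof of that condition is an argument. *)
Definition hq_class xi c (h : (xi, c) \in is_cycle) : HQ1 :=
  hq_proj (Cycle h).

Lemma hq_class_proj (p : cycles) :
  exists xi c (h : (xi, c) \in is_cycle), hq_proj p = hq_class h.
Proof. by case: p => [[xi c] h]; exists xi, c, h. Qed.

Lemma hq_class_rel xi c (h : (xi, c) \in is_cycle) :
  hq_rel (xi, c) -> hq_class h = 0.
Proof. by move=> rel; apply/qproj_eq0/span_in. Qed.

Lemma hq_classD xi c xi' c' xi2 c2 (h : (xi, c) \in is_cycle)
    (h' : (xi', c') \in is_cycle) (h2 : (xi2, c2) \in is_cycle) :
  xi2 = xi + xi' -> c2 = c + c' -> hq_class h2 = hq_class h + hq_class h'.
Proof.
move=> exi ec; rewrite /hq_class -raddfD; congr hq_proj.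
by apply: val_inj; rewrite /= exi ec.
Qed.

Fact nu_cycle x : (1 ⊗ x, 0) \in is_cycle.
Proof. by apply/is_cycleP; rewrite hoch_bE mul1r mulr1 subrr !raddf0 !addr0. Qed.

Fact sq_cycle x : (x ⊗ x, 0) \in is_cycle.
Proof. by apply/is_cycleP; rewrite hoch_bE subrr !raddf0 !addr0. Qed.

Lemma hq_swap r s (h : (r ⊗ s + s ⊗ r, 0) \in is_cycle)
    (h' : (0, r * s + bar (r * s)) \in is_cycle) : hq_class h = hq_class h'.
Proof.
rewrite (hq_classD (hq_rel_cycle (hq_rel_sym r s)) h') ?addr0 //; last first.
  by rewrite -opprD addNr.
by rewrite hq_class_rel ?add0r //; exact: hq_rel_sym.
Qed.

Fact bar_sym_cycle w : (0, w + bar w) \in is_cycle.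
Proof. by apply/is_cycleP; rewrite raddf0 add0r barD barK [bar w + w]addrC subrr. Qed.

Definition nu x : HQ1 := hq_class (nu_cycle x).

Fact nu0 : nu 0 = 0.
Proof.
apply: (addrI (nu 0)); rewrite addr0; apply/esym/hq_classD; rewrite ?addr0 //.
by rewrite -tensDr addr0.
Qed.

Fact nuD x y : nu (x + y) = nu x + nu y.
Proof. by apply: hq_classD; rewrite ?addr0 // tensDr. Qed.

HB.instance Definition _ := GRing.isNmodMorphism.Build R HQ1 nu (conj nu0 nuD).

Definition mu x : coker nu := cokproj nu (hq_class (sq_cycle x)).

Lemma nuE x : nu x = hq_class (bar_sym_cycle x).
Proof.
have h1 : (x ⊗ 1, 0) \in is_cycle.
  by apply/is_cycleP; rewrite hoch_bE mul1r mulr1 subrr !raddf0 !addr0.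
have h2 : (1 ⊗ x + x ⊗ 1, 0) \in is_cycle.
  by rewrite -[0](addr0 0) (rpredD (nu_cycle x) h1).
have h3 : (0, 1 * x + bar (1 * x)) \in is_cycle.
  by rewrite mul1r bar_sym_cycle.
have z1 : hq_class h1 = 0.
  apply: hq_class_rel; have := hq_rel_hoch 1 1 x.
  by rewrite !mul1r mulr1 subrr add0r.
have := hq_classD (nu_cycle x) h1 h2 erefl (esym (addr0 0)).
rewrite z1 addr0 -/(nu x) => <-; rewrite (hq_swap h2 h3).
by congr hq_proj; apply: val_inj; rewrite /= mul1r.
Qed.

Fact mu0 : mu 0 = 0.
Proof.
have e : hq_class (sq_cycle 0) = nu 0.
  apply: (congr1 hq_proj); apply: val_inj => /=; congr (_, _).
  by apply: (addrI (1 ⊗ 0)); rewrite -tensDl -tensDr !addr0.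
by rewrite /mu e nu0 raddf0.
Qed.

Fact muD x y : mu (x + y) = mu x + mu y.
Proof.
have h1 : (x ⊗ x + y ⊗ y, 0) \in is_cycle.
  by rewrite -[0](addr0 0) (rpredD (sq_cycle x) (sq_cycle y)).
have h2 : (x ⊗ y + y ⊗ x, 0) \in is_cycle.
  by apply/is_cycleP; rewrite raddfD /= !hoch_bE subrA !raddf0 !addr0.
rewrite /mu -raddfD -(hq_classD (sq_cycle x) (sq_cycle y) h1) ?addr0 //.
rewrite (hq_classD h1 h2 (sq_cycle (x + y))) ?addr0 //; last first.
  by rewrite tensDl !tensDr [y ⊗ x + _]addrC addrACA.
rewrite (hq_swap h2 (bar_sym_cycle _)) -nuE raddfD /=.
rewrite [X in _ + X](_ : _ = 0) ?addr0 //.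
by apply/qproj_eq0/span_in; exists (x * y).
Qed.

HB.instance Definition _ :=
  GRing.isNmodMorphism.Build R (coker nu) mu (conj mu0 muD).

End HQ1.

(* Main.v *)
(* Let S = R/2R and let A be the quotient of S⊗S ⊕ S by the relators of HQ_1(S)
   and by the elements (x⊗x, 0).  No cycle condition is imposed, but as all these
   elements are cycles, coker(mu_S) embeds into A.  In A one has x⊗y = y⊗x, so
   A × S with (a, d) + (a', d') = (a + a' + [d⊗d'], d + d') is an abelian group,
   and (a, b) |-> ([aba⊗b + ab⊗ba], ab + ba) is biadditive with values in it.
   The resulting additive map on R⊗R has, as first component, the quadratic part
   of theta; its second component is b(xi), which equals c + bar c on cycles.
   Hence the defect of additivity b(xi)⊗b(xi') of the first component cancels
   that of c |-> [c⊗bar c, c^2]. *)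
Require Import Defs.
From HB Require Import structures.
From mathcomp Require Import all_boot all_algebra.
From mathcomp Require Import ssrAC boolp.

Set Implicit Arguments.
Unset Strict Implicit.
Unset Printing Implicit Defensive.

Import GRing.Theory.
Local Open Scope ring_scope.

(** * Sums over index pairs and extensions twisted by a symmetric biadditive form *)

Lemma sum_lt_ordS (W : zmodType) n (F : 'I_n.+1 -> 'I_n.+1 -> W) :
  \sum_(i < n.+1) \sum_(j < n.+1 | (i < j)%N) F i j =
  \sum_(i < n) \sum_(j < n | (i < j)%N)
    F (widen_ord (leqnSn n) i) (widen_ord (leqnSn n) j)
  + \sum_(i < n) F (widen_ord (leqnSn n) i) ord_max.
Proof.
rewrite big_ord_recr /= [X in _ + X]big1 ?addr0 => [|j]; last first.
  by rewrite ltnNge -ltnS ltn_ord.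
rewrite -big_split /=; apply: eq_bigr => i _.
by rewrite big_mkcond big_ord_recr /= ltn_ord -big_mkcond.
Qed.

Record sym_biadditive (V W : zmodType) := SymBiadditive {
  biadd :> V -> V -> W;
  biaddDl : forall x y z, biadd (x + y) z = biadd x z + biadd y z;
  biaddDr : forall x y z, biadd x (y + z) = biadd x y + biadd x z;
  biaddC : forall x y, biadd x y = biadd y x
}.

Section TwistedSum.
Variables (V W : zmodType) (beta : sym_biadditive V W).

(* The extension of V by W with cocycle beta; the type carries beta so that
   the twisted addition can be found by unification. *)
Definition twisted_sum (_ : sym_biadditive V W) : Type := (W * V)%type.

Notation E := (twisted_sum beta).

HB.instance Definition _ := Choice.on E.

Definition twisted_zero : E := (0, 0).
Definition twisted_add (u v : E) : E :=
  (u.1 + v.1 + beta u.2 v.2, u.2 + v.2).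
(** The term [beta u.2 u.2] compensates the cocycle value [beta (- u.2) u.2]. *)
Definition twisted_opp (u : E) : E := (- u.1 + beta u.2 u.2, - u.2).

(** Biadditivity of [beta] is what gives the cocycle identity. *)
Fact twisted_addA : associative twisted_add.
Proof.
move=> [a x] [b y] [c z]; rewrite /twisted_add /=.
congr (_, _); last exact: addrA.
rewrite biaddDl biaddDr -!addrA; congr (_ + (_ + _)).
by rewrite [RHS]addrCA; congr (_ + _); rewrite [RHS]addrA [RHS]addrC.
Qed.

Fact twisted_addC : commutative twisted_add.
Proof.
move=> [a x] [b y]; rewrite /twisted_add /= biaddC (addrC x).
by rewrite [a + b]addrC.
Qed.

Fact twisted_add0 : left_id twisted_zero twisted_add.
Proof.
move=> [a x]; rewrite /twisted_add /= !add0r; congr (_, _).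
suff -> : beta 0 x = 0 by rewrite addr0.
by apply: (addrI (beta 0 x)); rewrite -biaddDl !addr0.
Qed.

Fact twisted_addN : left_inverse twisted_zero twisted_opp twisted_add.
Proof.
move=> [a x]; rewrite /twisted_add /twisted_opp /=.
congr (_, _); last exact: addNr.
rewrite [- a + _ + a]addrAC addNr add0r -biaddDl subrr.
by apply: (addrI (beta 0 x)); rewrite -biaddDl !addr0.
Qed.

HB.instance Definition _ := GRing.isZmodule.Build E
  twisted_addA twisted_addC twisted_add0 twisted_addN.

Lemma twisted_addE (u v : E) :
  u + v = (u.1 + v.1 + beta u.2 v.2, u.2 + v.2) :> E.
Proof. by []. Qed.

Definition twisted_snd (u : E) : V := u.2.

Fact twisted_snd_is_zmod_morphism : zmod_morphism twisted_snd.
Proof. by []. Qed.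

HB.instance Definition _ := GRing.isZmodMorphism.Build E V twisted_snd
  twisted_snd_is_zmod_morphism.

(** Origin of the sum over i < j in theta: the last summand is paired by the cocycle with the
    accumulated second component, which biadditivity expands. *)
Lemma twisted_sum_fst n (u : 'I_n -> E) :
  (\sum_(i < n) u i).1 =
  \sum_(i < n) (u i).1
  + \sum_(i < n) \sum_(j < n | (i < j)%N) beta (u i).2 (u j).2.
Proof.
elim: n u => [|n IHn] u; first by rewrite !big_ord0 addr0.
have biadd_suml (I : finType) (F : I -> V) y :
    beta (\sum_i F i) y = \sum_i beta (F i) y.
  elim/big_rec2: _ => [|i x z _ <-]; last by rewrite biaddDl.
  by apply: (addrI (beta 0 y)); rewrite -biaddDl !addr0.
rewrite sum_lt_ordS !big_ord_recr /= IHn -!addrA; congr (_ + _).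
rewrite [RHS]addrCA; congr (_ + (_ + _)).
have -> (x : E) : x.2 = twisted_snd x by [].
by rewrite raddf_sum biadd_suml.
Qed.

End TwistedSum.

(** * The quadratic lift in characteristic 2 and its vanishing on the relators *)

Section QuadraticLift.
Variables (R S : antiInvRingType) (p : {rmorphism R -> S}) (A : zmodType).
(** [t x y] and [e c] model the classes of [(x ⊗ y, 0)] and [(0, c)]; the hypotheses are the
    relators modulo 2, with squares killed. *)
Variables (t : S -> S -> A) (e : {additive S -> A}).

Hypothesis p_bar : forall x, p (bar x) = bar (p x).
Hypothesis S_char2 : forall x : S, x + x = 0.
Hypothesis A_char2 : forall a : A, a + a = 0.
Hypothesis tDl : forall x y z, t (x + y) z = t x z + t y z.
Hypothesis tDr : forall x y z, t x (y + z) = t x y + t x z.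
Hypothesis txx : forall x, t x x = 0.
Hypothesis t_hoch : forall x y z,
  t (x * y) z + t x (y * z) + t (z * x) y = 0.
Hypothesis t_bar : forall u v, t u v + t (bar u) (bar v) = e (v * u + u * v).
Hypothesis e_bar : forall w, e (w + bar w) = 0.

Let opp_char2 (V : zmodType) (V2 : forall x : V, x + x = 0) (x : V) : - x = x.
Proof. by apply/eqP; rewrite eq_sym -addr_eq0 V2. Qed.

Let cancel_char2 (V : zmodType) (V2 : forall x : V, x + x = 0) (x y : V) :
  x + (x + y) = y.
Proof. by rewrite addrA V2 add0r. Qed.

Let eq_char2 (V : zmodType) (V2 : forall x : V, x + x = 0) (x y : V) :
  x + y + 0 = 0 -> x = y.
Proof. by rewrite addr0 => /eqP; rewrite addr_eq0 opp_char2 // => /eqP. Qed.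

(* Moves all summands to one side and cancels equal ones in pairs. *)
Ltac char2 H :=
  apply: (eq_char2 H); rewrite -?addrA;
  repeat first
    [ rewrite (cancel_char2 H)
    | match goal with |- ?x + _ = 0 => rewrite [_ + (x + _)]addrCA end ];
  rewrite ?addr0; try done.

(** Polarization of [txx]; signs are irrelevant in [A]. *)
Let tC x y : t x y = t y x.
Proof.
have := txx (x + y); rewrite tDl !tDr !txx add0r addr0 => /eqP.
by rewrite addr_eq0 (opp_char2 A_char2) => /eqP.
Qed.

Let hoch x y z : t (x * y) z = t x (y * z) + t (z * x) y.
Proof. by apply: (eq_char2 A_char2); rewrite addr0 addrA t_hoch. Qed.

Definition square_form : sym_biadditive S A := SymBiadditive tDl tDr tC.

Notation E := (twisted_sum square_form).

Definition quad_tens (a b : S) : A := t (a * b * a) b + t (a * b) (b * a).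

Definition quad_pair (a b : R) : E :=
  (quad_tens (p a) (p b), p a * p b + p b * p a).

Fact quad_pairDl a a' b : quad_pair (a + a') b = quad_pair a b + quad_pair a' b.
Proof.
rewrite twisted_addE /quad_pair /quad_tens /= !rmorphD /=.
set x := p a; set x' := p a'; set y := p b.
congr (_, _); last by rewrite mulrDl mulrDr; char2 S_char2.
(* The Hochschild relation turns each of the cross terms [t (x * y * x') y] and [t (x' * y * x) y]
   into a cocycle term plus [t x' (y * x * y)], up to symmetry; the latter cancels. *)
rewrite !(mulrDl, mulrDr, tDl, tDr) (hoch (x * y) x' y).
rewrite !mulrA -(mulrA x' y x) (hoch x' (y * x) y).
rewrite (tC (y * x) (x' * y)) (tC (y * x) (y * x')) (tC x' (y * x * y)).
by char2 A_char2.
Qed.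

Fact quad_pairDr a b b' : quad_pair a (b + b') = quad_pair a b + quad_pair a b'.
Proof.
rewrite twisted_addE /quad_pair /quad_tens /= !rmorphD /=.
set x := p a; set y := p b; set y' := p b'.
congr (_, _); last by rewrite mulrDl mulrDr; char2 S_char2.
(* Both uses of the Hochschild relation produce [t (y' * x * y) x], which cancels. *)
rewrite !(mulrDl, mulrDr, tDl, tDr) (hoch (x * y) x y').
rewrite (hoch y x (y' * x)) !mulrA (tC (x * y' * x)) (tC (y * x) (x * y')).
by char2 A_char2.
Qed.

Definition quad_lift : tensor R R -> E := tlift quad_pair.

HB.instance Definition _ := GRing.isZmodMorphism.Build (tensor R R) E quad_lift
  (tlift_is_zmod_morphism quad_pairDl quad_pairDr).

Lemma quad_liftE a b : quad_lift (a ⊗ b) = quad_pair a b.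
Proof. exact: (tliftE quad_pairDl quad_pairDr). Qed.

Lemma quad_lift_snd xi : (quad_lift xi).2 = p (hoch_b xi).
Proof.
have [n [a [b ->]]] := tensor_sumE xi; rewrite !raddf_sum /=.
rewrite [LHS](raddf_sum (twisted_snd (beta := square_form))) /=.
apply: eq_bigr => i _; rewrite quad_liftE hoch_bE rmorphB !rmorphM /=.
by rewrite (opp_char2 S_char2).
Qed.

Lemma quad_lift_fst n (a b : 'I_n -> R) :
  (quad_lift (\sum_(i < n) a i ⊗ b i)).1 =
  \sum_(i < n) quad_tens (p (a i)) (p (b i))
  + \sum_(i < n) \sum_(j < n | (i < j)%N)
      t (p (a i) * p (b i) + p (b i) * p (a i))
        (p (a j) * p (b j) + p (b j) * p (a j)).
Proof.
rewrite raddf_sum twisted_sum_fst; congr (_ + _); apply: eq_bigr => i _.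
  by rewrite /= quad_liftE.
by apply: eq_bigr => j _; rewrite /= !quad_liftE.
Qed.

Definition theta_cycle (z : cycles R) : A :=
  (quad_lift z.1).1 + t (p z.2) (bar (p z.2)) + e (p z.2 ^+ 2).

Let hoch_b_cycle (z : cycles R) : p (hoch_b z.1) = p z.2 + bar (p z.2).
Proof.
case: z => [[xi c] /= /is_cycleP /eqP]; rewrite subr_eq0 => /eqP h.
have -> : hoch_b xi = bar c - c by rewrite -h addrK.
by rewrite rmorphB /= p_bar (opp_char2 S_char2) addrC.
Qed.

Lemma commutator_sum_cycle n (a b : 'I_n -> R) c :
  (\sum_(i < n) a i ⊗ b i, c) \in @is_cycle R ->
  \sum_(i < n) (p (a i) * p (b i) + p (b i) * p (a i)) = p c + bar (p c).
Proof.
move=> Hc; rewrite -(hoch_b_cycle (Cycle Hc)) /= !raddf_sum /=.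
apply: eq_bigr => i _; rewrite hoch_bE rmorphB !rmorphM /=.
by rewrite (opp_char2 S_char2).
Qed.

(** On cycles the cocycle is [t (c + bar c) (c' + bar c')]. Its mixed terms cancel the cross terms
    of [t c (bar c)]; the other two cancel [e (c * c' + c' * c)] by [t_bar]. *)
Fact theta_cycleD z z' : theta_cycle (z + z') = theta_cycle z + theta_cycle z'.
Proof.
rewrite /theta_cycle raddfD /= !raddfD /= !quad_lift_snd !hoch_b_cycle.
set c := p z.2; set c' := p z'.2.
rewrite !expr2.
have -> : e ((c + c') * (c + c'))
  = e (c * c) + e (c' * c') + (t c c' + t (bar c) (bar c')).
  by rewrite t_bar -!(raddfD e); congr (e _); rewrite mulrDl !mulrDr; char2 S_char2.
rewrite !(tDl, tDr) (tC c' (bar c)).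
by char2 A_char2.
Qed.

Lemma theta_cycle_rel (z : cycles R) : hq_rel z -> theta_cycle z = 0.
Proof.
(* [t_bar] at [w] and [bar w] has equal summands on its left side. *)
have e_norm w : e (w * bar w + bar w * w) = 0.
  by rewrite addrC -t_bar barK [t (bar w) w]tC A_char2.
move=> zrel; rewrite /theta_cycle.
case: {z} (cycle_val z) / zrel => [r s|u v|w|x y z] /=.
- rewrite raddfD /= !quad_liftE /= !rmorphD /= !rmorphN /= p_bar rmorphM /=.
  rewrite !(opp_char2 S_char2); set x := p r; set y := p s.
  (* Here the two commutators agree modulo 2 and [c] is fixed by [bar], so the cocycle and
     [t c (bar c)] are diagonal values of [t]. *)
  rewrite /quad_tens (addrC (y * x)) txx addr0.
  rewrite [bar (_ + bar _)]raddfD /= barK [bar (x * y) + _]addrC txx addr0.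
  have -> : e ((x * y + bar (x * y)) ^+ 2) = 0.
    move: (x * y) => w; rewrite expr2 mulrDl !mulrDr.
    have -> : w * w + w * bar w + (bar w * w + bar w * bar w)
      = (w * w + bar (w * w)) + (w * bar w + bar w * w).
      by rewrite barM; char2 S_char2.
    by rewrite raddfD /= e_bar e_norm addr0.
  rewrite addr0 (hoch (x * y) x y) !mulrA (tC (y * x)) txx.
  by char2 A_char2.
- rewrite raddfD /= !quad_liftE /= rmorphB /= !rmorphM /= !p_bar.
  rewrite (opp_char2 S_char2); set x := p u; set y := p v.
  rewrite /quad_tens raddfD /= !barM.
  (* The square is grouped so that [t_bar] at [(x * y * x, y)] and at [(x * y, y * x)] yields
     exactly the summands of the two [quad_tens]. The cocycle cancels [t c (bar c)]. *)
  have -> : e ((y * x + x * y) ^+ 2)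
    = e (y * (x * y * x) + x * y * x * y) + e (y * x * (x * y) + x * y * (y * x)).
    rewrite -(raddfD e) expr2 mulrDl !mulrDr !mulrA; congr (e _).
    by char2 S_char2.
  rewrite -!t_bar !barM !(tDl, tDr) !mulrA.
  rewrite (tC (bar y * bar x) (bar x * bar y)).
  by char2 A_char2.
- by rewrite raddf0 raddfMn mulr2n S_char2 !raddf0 txx expr0n raddf0 !addr0.
- rewrite raddfD raddfB /= !raddf0 !txx expr0n raddf0 !addr0 !quad_liftE.
  rewrite (opp_char2 A_char2) (opp_char2 S_char2) /quad_pair /quad_tens /=.
  rewrite !rmorphM /=; move: (p x) (p y) (p z) => {}x {}y {}z.
  rewrite !(tDl, tDr) !mulrA !txx.
  (* This instance removes the first terms of the three [quad_tens]. Their second terms pair the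
     rotations xyz, zxy, yzx and cancel against the cocycles. *)
  rewrite (hoch (x * y * z * x) y z) !mulrA.
  rewrite (tC (x * y * z) (z * x * y)) (tC (y * z * x)).
  by char2 A_char2.
Qed.

End QuadraticLift.

(** * Images as subgroups and additive maps out of quotients *)

Lemma span_image (V W : zmodType) (f : {additive V -> W}) y :
  Defs.span (fun y => exists x, y = f x) y -> exists x, y = f x.
Proof.
elim=> {y} [//||_ _ _ [x ->] _ [x' ->]]; first by exists 0; rewrite raddf0.
by exists (x - x'); rewrite raddfB.
Qed.

Lemma gquot_additive (V W : zmodType) (P : V -> Prop) (f : {additive V -> W}) :
  (forall x, P x -> f x = 0) ->
  exists g : {additive gquot P -> W}, forall x, g (qproj P x) = f x.
Proof.
move=> fP; pose g (q : gquot P) := f (qrepr q).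
have gE x : g (qproj P x) = f x.
  apply/eqP; rewrite -subr_eq0 -raddfB; apply/eqP/(span_ker fP)/qproj_eq.
  exact: qreprK.
have gB : zmod_morphism g.
  by move=> q r; rewrite -[q]qreprK -[r]qreprK -raddfB !gE raddfB.
pose gA := GRing.isZmodMorphism.Build _ _ g gB.
by exists (HB.pack_for {additive gquot P -> W} g gA).
Qed.

Lemma tens0l (V W : zmodType) (w : W) : (0 : V) ⊗ w = 0.
Proof. by apply: (addrI (0 ⊗ w)); rewrite -tensDl !addr0. Qed.

(** * Embedding of coker(mu) into a quotient of S ⊗ S ⊕ S *)

Section SquareQuotient.
Variable S : antiInvRingType.

Definition coker_proj (h : HQ1 S) : coker (@mu S) :=
  cokproj (@mu S) (cokproj (@nu S) h).

Fact coker_proj_is_zmod_morphism : zmod_morphism coker_proj.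
Proof. by move=> h h'; rewrite /coker_proj !raddfB. Qed.

HB.instance Definition _ := GRing.isZmodMorphism.Build (HQ1 S) (coker (@mu S))
  coker_proj coker_proj_is_zmod_morphism.

Lemma coker_projK (q : coker (@mu S)) : coker_proj (qrepr (qrepr q)) = q.
Proof. by rewrite /coker_proj /cokproj !qreprK. Qed.

Definition is_square (h : HQ1 S) : Prop := exists x, h = hq_class (sq_cycle x).

(* Polarizing [x ⊗ x, 0] at 1 and x gives 1 ⊗ x + x ⊗ 1, and x ⊗ 1 is a
   Hochschild boundary. *)
Lemma span_square_nu x : Defs.span is_square (nu x).
Proof.
have h1 : (x ⊗ 1, 0) \in @is_cycle S.
  by apply/is_cycleP; rewrite hoch_bE mul1r mulr1 subrr !raddf0 !addr0.
have z1 : hq_class h1 = 0.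
  apply: hq_class_rel; have := hq_rel_hoch 1 1 x.
  by rewrite !mul1r mulr1 subrr add0r.
have -> : nu x = hq_class (sq_cycle (1 + x)) - hq_class (sq_cycle 1)
                 - hq_class (sq_cycle x).
  transitivity (nu x + hq_class h1); first by rewrite z1 addr0.
  rewrite /nu /hq_class -raddfD -!raddfB; apply: (congr1 (@hq_proj S)).
  apply: val_inj => /=; congr (_, _); last by rewrite /= ?subr0 ?oppr0 ?addr0.
  rewrite /= tensDl !tensDr -[1 ⊗ 1 + _ + _]addrA [1 ⊗ 1 + _]addrC addrK.
  by rewrite addrA addrK.
by apply/span_B; [apply/span_B|]; apply/span_in; eexists.
Qed.

(** A class killed by both projections is a square class plus a value of [nu], and [span_square_nu]
    absorbs the latter. *)
Lemma coker_proj_eq0 h : coker_proj h = 0 <-> Defs.span is_square h.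
Proof.
split=> [|hsq]; last first.
  apply: (span_ker (f := coker_proj)) hsq => _ [x ->].
  by apply/qproj_eq0/span_in; exists x.
move/qproj_eq0/span_image => [x] /qproj_eq/span_image[y] /eqP.
rewrite subr_eq => /eqP ->; rewrite -[hq_class _]opprK; apply: span_B.
  exact: span_square_nu.
by rewrite -[- _]add0r; apply: span_B; [exact: span_0|apply: span_in; exists x].
Qed.

Inductive quad_rel : tensor S S * S -> Prop :=
| quad_rel_hq z : hq_rel z -> quad_rel z
| quad_rel_square x : quad_rel (x ⊗ x, 0).

(* All relators are cycles, so dropping the cycle condition loses no
   information about cycles. *)
Lemma quad_rel_coker (z : cycles S) :
  Defs.span quad_rel (val z) -> coker_proj (hq_proj z) = 0.
Proof.
suff H v : Defs.span quad_rel v ->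
    exists h : v \in @is_cycle S, coker_proj (hq_proj (Cycle h)) = 0.
  move=> /H[h]; rewrite (_ : Cycle h = z) //; exact: val_inj.
elim=> {v} [v [v' rel|x]||v w _ [hv v0] _ [hw w0]].
- exists (hq_rel_cycle rel); rewrite (_ : hq_proj _ = 0) ?raddf0 //.
  exact/qproj_eq0/span_in.
- exists (sq_cycle x); by apply/coker_proj_eq0/span_in; exists x.
- exists (rpred0 _); rewrite (_ : Cycle _ = 0) ?raddf0 //; exact: val_inj.
- exists (rpredB hv hw); rewrite (_ : Cycle _ = Cycle hv - Cycle hw).
    by rewrite (raddfB (@hq_proj S)) (raddfB coker_proj) /= v0 w0 subr0.
  exact: val_inj.
Qed.

Definition quad_quot : Type := gquot quad_rel.

HB.instance Definition _ := GRing.Zmodule.on quad_quot.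

Definition quad_i (u : tensor S S) : quad_quot := qproj quad_rel (u, 0).
Definition quad_t (x y : S) : quad_quot := quad_i (x ⊗ y).
Definition quad_e (c : S) : quad_quot := qproj quad_rel (0, c).

Fact quad_i_is_zmod_morphism : zmod_morphism quad_i.
Proof.
move=> u u'; rewrite /quad_i -raddfB; congr (qproj _ _).
by congr (_, _); rewrite subr0.
Qed.

HB.instance Definition _ := GRing.isZmodMorphism.Build (tensor S S) quad_quot
  quad_i quad_i_is_zmod_morphism.

Fact quad_e_is_zmod_morphism : zmod_morphism quad_e.
Proof.
move=> c c'; rewrite /quad_e -raddfB; congr (qproj _ _).
by congr (_, _); rewrite subr0.
Qed.

HB.instance Definition _ := GRing.isZmodMorphism.Build S quad_quot quad_e
  quad_e_is_zmod_morphism.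

Lemma quad_projE u c : qproj quad_rel (u, c) = quad_i u + quad_e c.
Proof.
rewrite /quad_i /quad_e -(raddfD (qproj quad_rel)); congr (qproj _ _).
by congr (_, _); rewrite /= ?addr0 ?add0r.
Qed.

Lemma quad_tDl x y z : quad_t (x + y) z = quad_t x z + quad_t y z.
Proof. by rewrite /quad_t tensDl raddfD. Qed.

Lemma quad_tDr x y z : quad_t x (y + z) = quad_t x y + quad_t x z.
Proof. by rewrite /quad_t tensDr raddfD. Qed.

Lemma quad_txx x : quad_t x x = 0.
Proof. by apply/qproj_eq0/span_in; exact: quad_rel_square. Qed.

Hypothesis S_char2 : forall x : S, x + x = 0.

Let S_opp (x : S) : - x = x.
Proof. by apply/eqP; rewrite eq_sym -addr_eq0 S_char2. Qed.

Lemma tensor_char2 (u : tensor S S) : u + u = 0.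
Proof.
have [n [a [b ->]]] := tensor_sumE u; rewrite -big_split big1 // => i _ /=.
by rewrite -tensDl S_char2 tens0l.
Qed.

Lemma quad_quot_char2 (q : quad_quot) : q + q = 0.
Proof.
rewrite -[q]qreprK -(raddfD (qproj quad_rel)); apply/qproj_eq0.
by case: (qrepr q) => u c; rewrite (_ : _ + _ = 0);
  [exact: span_0|congr (_, _); [exact: tensor_char2|exact: S_char2]].
Qed.

Let tensor_opp (u : tensor S S) : - u = u.
Proof. by apply/eqP; rewrite eq_sym -addr_eq0 tensor_char2. Qed.

Lemma quad_t_hoch x y z :
  quad_t (x * y) z + quad_t x (y * z) + quad_t (z * x) y = 0.
Proof.
rewrite /quad_t -!(raddfD quad_i); apply/qproj_eq0/span_in/quad_rel_hq.
by have := hq_rel_hoch x y z; rewrite tensor_opp.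
Qed.

Lemma quad_t_bar u v :
  quad_t u v + quad_t (bar u) (bar v) = quad_e (v * u + u * v).
Proof.
rewrite -[LHS]addr0 -(quad_quot_char2 (quad_e (v * u + u * v))) addrA.
rewrite /quad_t -(raddfD quad_i) -quad_projE.
suff -> : qproj quad_rel (u ⊗ v + bar u ⊗ bar v, v * u + u * v) = 0.
  by rewrite add0r.
apply/qproj_eq0/span_in/quad_rel_hq.
by have := hq_rel_bar u v; rewrite S_opp.
Qed.

(** Polarizing squares at 1 and [w] kills [1 ⊗ w + w ⊗ 1], so the symmetry relator at [(1, w)]
    reduces to its second component. *)
Lemma quad_e_bar w : quad_e (w + bar w) = 0.
Proof.
have h := quad_txx (1 + w).
rewrite quad_tDl !quad_tDr !quad_txx add0r addr0 /quad_t -(raddfD quad_i) in h.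
have : qproj quad_rel (1 ⊗ w + w ⊗ 1, - (1 * w) - bar (1 * w)) = 0.
  by apply/qproj_eq0/span_in/quad_rel_hq; exact: hq_rel_sym.
by rewrite mul1r !S_opp quad_projE h add0r.
Qed.

(** With d_i = a_i b_i + b_i a_i, the first two sums contribute the squares d_i^2 and the pairs i <
    j contribute d_i d_j + d_j d_i. *)
Lemma commutator_sum_sq n (a b : 'I_n -> S) :
  hoch_b (\sum_(i < n) (a i * b i * a i) ⊗ b i
          + \sum_(i < n) (a i * b i) ⊗ (b i * a i)
          + \sum_(i < n) \sum_(j < n | (i < j)%N)
             (a i * b i + b i * a i) ⊗ (a j * b j + b j * a j))
  = (\sum_(i < n) (a i * b i + b i * a i)) ^+ 2.
Proof.
rewrite !raddfD /= !raddf_sum /= -big_split /=.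
pose d i := a i * b i + b i * a i.
rewrite (eq_bigr (fun i => d i ^+ 2)) => [|i _]; last first.
  rewrite !hoch_bE !S_opp expr2 /d mulrDl !mulrDr !mulrA -!addrA; congr (_ + _).
  by rewrite addrC -addrA; congr (_ + _); rewrite addrC.
under [X in _ + X]eq_bigr => i _ do
  (rewrite raddf_sum /=; under eq_bigr => j _ do rewrite hoch_bE S_opp -!/(d _)).
under [X in _ = X ^+ 2]eq_bigr do rewrite -/(d _).
move: d => {a b}; elim: n => [|n IHn] d; first by rewrite !big_ord0 addr0 expr2 mul0r.
rewrite sum_lt_ordS !big_ord_recr /= [RHS]expr2 mulrDl !mulrDr -!expr2.
rewrite -IHn big_split /= -mulr_suml -mulr_sumr.
rewrite -!addrA; congr (_ + _).
by rewrite [LHS]addrCA; congr (_ + _); rewrite [LHS]addrC -addrA.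
Qed.

(** The boundary is (c + bar c)^2 plus the commutator of c and bar c; after adding c^2 and its
    conjugate, every monomial occurs twice. *)
Lemma quad_is_cycle n (a b : 'I_n -> S) c :
  \sum_(i < n) (a i * b i + b i * a i) = c + bar c ->
  (\sum_(i < n) (a i * b i * a i) ⊗ b i
   + \sum_(i < n) (a i * b i) ⊗ (b i * a i)
   + \sum_(i < n) \sum_(j < n | (i < j)%N)
      (a i * b i + b i * a i) ⊗ (a j * b j + b j * a j)
   + c ⊗ bar c, c ^+ 2) \in @is_cycle S.
Proof.
move=> dE; apply/is_cycleP; rewrite raddfD /= commutator_sum_sq dE hoch_bE.
rewrite !S_opp !expr2 barM mulrDl !mulrDr.
move: (c * c) (c * bar c) (bar c * c) (bar c * bar c) => x y z w.
by rewrite !addrA (ACl ((1*7)*(2*5)*(3*6)*(4*8))%AC) /= !S_char2.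
Qed.

End SquareQuotient.

(** * Theta on the cycles of R, with values in coker(mu) *)

Section Theta.
Variable R : antiInvRingType.

Notation S := (mod2 R).
Notation p := (@to_mod2 R).

Fact to_mod2_barC x : p (bar x) = bar (p x).
Proof. by rewrite bar_to_mod2. Qed.

Fact mod2_char2 (x : S) : x + x = 0.
Proof.
rewrite -[x]to_mod2K -raddfD -[RHS](raddf0 (@to_mod2 R)); apply/to_mod2P.
by exists (qrepr x); rewrite add0r mulr2n.
Qed.

Let A2 := quad_quot_char2 mod2_char2.

Definition theta_quad : cycles R -> quad_quot S :=
  theta_cycle p (@quad_e S) A2 (@quad_tDl S) (@quad_tDr S) (@quad_txx S).

Lemma theta_quadD z z' : theta_quad (z + z') = theta_quad z + theta_quad z'.
Proof.
apply: theta_cycleD; [exact: to_mod2_barC|exact: mod2_char2|idtac|idtac].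
  exact: quad_t_hoch mod2_char2.
exact: quad_t_bar mod2_char2.
Qed.

Lemma theta_quad_rel z : hq_rel (val z) -> theta_quad z = 0.
Proof.
apply: theta_cycle_rel; [exact: to_mod2_barC|exact: mod2_char2|idtac|idtac|idtac].
- exact: quad_t_hoch mod2_char2.
- exact: quad_t_bar mod2_char2.
- exact: quad_e_bar mod2_char2.
Qed.

(** Places the value in the image of coker(mu): the cycle condition on [c] gives the commutator sum
    required by [quad_is_cycle]. *)
Lemma theta_quadE n (a b : 'I_n -> R) c
    (Hc : (\sum_(i < n) a i ⊗ b i, c) \in @is_cycle R) :
  exists Hd :
    (\sum_(i < n) p (a i * b i * a i) ⊗ p (b i)
     + \sum_(i < n) p (a i * b i) ⊗ p (b i * a i)
     + \sum_(i < n) \sum_(j < n | (i < j)%N)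
         p (a i * b i + b i * a i) ⊗ p (a j * b j + b j * a j)
     + p c ⊗ bar (p c),
     (p c) ^+ 2) \in @is_cycle S,
  theta_quad (Cycle Hc) = qproj (@quad_rel S) (val (Cycle Hd)).
Proof.
have Xe : \sum_(i < n) p (a i * b i * a i) ⊗ p (b i)
    + \sum_(i < n) p (a i * b i) ⊗ p (b i * a i)
    + \sum_(i < n) \sum_(j < n | (i < j)%N)
        p (a i * b i + b i * a i) ⊗ p (a j * b j + b j * a j)
  = \sum_(i < n) (p (a i) * p (b i) * p (a i)) ⊗ p (b i)
    + \sum_(i < n) (p (a i) * p (b i)) ⊗ (p (b i) * p (a i))
    + \sum_(i < n) \sum_(j < n | (i < j)%N)
        (p (a i) * p (b i) + p (b i) * p (a i))
          ⊗ (p (a j) * p (b j) + p (b j) * p (a j)).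
  congr (_ + _ + _); apply: eq_bigr => i _; rewrite ?rmorphM ?rmorphM //.
  by apply: eq_bigr => j _; rewrite !rmorphD !rmorphM.
have dE := commutator_sum_cycle to_mod2_barC mod2_char2 Hc.
rewrite Xe; exists (quad_is_cycle mod2_char2 dE); rewrite /= quad_projE.
congr (_ + _); rewrite [quad_i _]raddfD /= -/(quad_t _ _); congr (_ + _).
rewrite (quad_lift_fst _ mod2_char2 _ _ _ _ (quad_t_hoch mod2_char2)).
rewrite !raddfD /= !raddf_sum /= big_split; congr (_ + _ + _).
by apply: eq_bigr => i _; rewrite raddf_sum.
Qed.

Lemma theta_quad_lift z :
  exists z' : cycles S, theta_quad z = qproj (@quad_rel S) (val z').
Proof.
case: z => [[xi c] Hc]; have [n [a [b xiE]]] := tensor_sumE xi.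
by subst xi; have [Hd ->] := theta_quadE Hc; exists (Cycle Hd).
Qed.

(** The cycle lifting [theta_quad z] is picked by choice; [quad_rel_coker] makes the class
    independent of it. *)
Definition theta_coker (z : cycles R) : coker (@mu S) :=
  coker_proj (hq_proj (projT1 (cid (theta_quad_lift z)))).

Lemma theta_cokerE z z' :
  theta_quad z = qproj (@quad_rel S) (val z') ->
  theta_coker z = coker_proj (hq_proj z').
Proof.
rewrite /theta_coker; case: cid => z2 /= -> /qproj_eq e.
apply/eqP; rewrite -subr_eq0 -!raddfB; apply/eqP/quad_rel_coker; exact: e.
Qed.

Fact theta_coker_is_nmod_morphism : nmod_morphism theta_coker.
Proof.
have repD z z' : theta_coker (z + z') = theta_coker z + theta_coker z'.
  have [w wE] := theta_quad_lift z; have [w' wE'] := theta_quad_lift z'.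
  rewrite (theta_cokerE wE) (theta_cokerE wE') -!raddfD; apply: theta_cokerE.
  by rewrite theta_quadD wE wE' -raddfD.
by split=> //; apply: (addrI (theta_coker 0)); rewrite -repD !addr0.
Qed.

HB.instance Definition _ := GRing.isNmodMorphism.Build (cycles R) (coker (@mu S))
  theta_coker theta_coker_is_nmod_morphism.

Lemma theta_coker_rel z : hq_rel (val z) -> theta_coker z = 0.
Proof.
by move=> zrel; rewrite (@theta_cokerE z 0) ?raddf0 // theta_quad_rel.
Qed.

End Theta.

(** * Descent of theta to [HQ1 R] and the two descriptions of its target *)

Theorem theorem2p17 (R : antiInvRingType) :
  let p := @to_mod2 R in
  let square_class (h : HQ1 (mod2 R)) : Prop :=
    exists x : R, h = hq_class (sq_cycle (p x)) in
  (exists phi : {additive gquot square_class -> coker (@mu (mod2 R))},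
      bijective phi /\
      forall h : HQ1 (mod2 R),
        phi (qproj square_class h)
        = cokproj (@mu (mod2 R)) (cokproj (@nu (mod2 R)) h)) /\
  (exists theta : {additive HQ1 R -> coker (@mu (mod2 R))},
      forall (n : nat) (a b : 'I_n -> R) (c : R)
             (Hc : (\sum_(i < n) a i ⊗ b i, c) \in @is_cycle R),
      exists Hd :
        (\sum_(i < n) p (a i * b i * a i) ⊗ p (b i)
         + \sum_(i < n) p (a i * b i) ⊗ p (b i * a i)
         + \sum_(i < n) \sum_(j < n | (i < j)%N)
             p (a i * b i + b i * a i) ⊗ p (a j * b j + b j * a j)
         + p c ⊗ bar (p c),
         (p c) ^+ 2) \in @is_cycle (mod2 R),
        theta (hq_class Hc)
        = cokproj (@mu (mod2 R)) (cokproj (@nu (mod2 R)) (hq_class Hd))).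
Proof.
move=> p sq; split; last first.
  have [th thE] := gquot_additive (f := @theta_coker R) (@theta_coker_rel R).
  exists th => n a b c Hc; have [Hd e] := theta_quadE Hc; exists Hd.
  by rewrite [LHS]thE; exact: theta_cokerE.
(* Squares of elements coming from [R] exhaust all squares, as [to_mod2] is surjective. *)
have sqE h : sq h <-> is_square h.
  split=> [[x ->]|[x ->]]; first by exists (p x).
  by exists (qrepr x); rewrite /p to_mod2K.
have span_sq h : Defs.span sq h <-> Defs.span (@is_square (mod2 R)) h.
  by split; elim=> {h} [h /sqE ?||]; do ?[exact: span_in|exact: span_0|
    move=> *; exact: span_B].
have [phi phiE] := @gquot_additive _ _ sq (@coker_proj (mod2 R))
  (fun h hsq => (coker_proj_eq0 h).2 (span_in (proj1 (sqE h) hsq))).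
exists phi; split; last exact: phiE.
(* The inverse picks representatives through coker(mu) and then coker(nu); it is a left inverse
   because [coker_proj] has the span of the squares as kernel. *)
exists (fun q => qproj sq (qrepr (qrepr q))) => q; last first.
  by rewrite phiE; exact: coker_projK.
rewrite -[q in RHS]qreprK; apply/qproj_eq/span_sq/coker_proj_eq0.
by rewrite raddfB [X in X - _]coker_projK -phiE qreprK subrr.
Qed.
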